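(* Let $a,b,g,h$ be real functions on $[0,\infty)$ with $a(t)\ge 0$, $b(t)\ge 0$, $g(t)\le t$, $h(t)\ge t$ and $\lim_{t\to\infty}g(t)=\infty$. Suppose that $a$ and $b$ are continuous and bounded on $[0,\infty)$, that $g$ and $h$ are equicontinuous on $[0,\infty)$, and that there exist positive numbers $a_1,a_2,b_1,b_2,\tau,\sigma,t_1$ such that $$a_1\le a(t)\le a_2,\quad b_1\le b(t)\le b_2,\quad t-g(t)\le\tau,\quad h(t)-t\le\sigma,\quad t\ge t_1,$$ and at least one of the following conditions holds: 1) $\displaystyle b_2<a_1,\quad 0<a_2-b_1<\frac{1}{\tau+\sigma}\ln\frac{a_1}{b_2}$; 2) $\displaystyle a_2<b_1,\quad 0<b_2-a_1<\frac{1}{\tau+\sigma}\ln\frac{b_1}{a_2}$. Then the equation $$\dot{x}(t)-a(t)x(g(t))+b(t)x(h(t))=0,\quad t\ge t_0,$$ has a nonoscillatory solution.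
   Context: Here $t_0\ge 0$. For a single function, ''equicontinuous on $[0,\infty)$'' means uniformly continuous on $[0,\infty)$. A solution of the differential equation is a function $x:\mathbb{R}\to\mathbb{R}$, absolutely continuous on each interval $[t_0,c]$, which satisfies the equation for almost all $t\in[t_0,\infty)$ and satisfies $x(t)=\varphi(t)$ for $t<t_0$, $x(t_0)=x_0$, for some initial function $\varphi$ and initial value $x_0$. A solution $x(t)$, $t_0\le t<\infty$, is nonoscillatory if there exists $T$ such that $x(t)\ne 0$ for all $t\ge T$.
   Formalization: The formal theorem assumes t0 ≥ t1, so that the bounds on a, b, t−g(t), h(t)−t hold on all of [t0,∞); for t0 < t1 the claim fails, since the behaviour on [t0,t1] can force every solution to vanish at a point and hence oscillate. *)

(* Defs.v *)
From HB Require Import structures.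
From mathcomp Require Export all_boot all_order all_algebra.
From mathcomp Require Export all_classical all_reals all_analysis.
Export numFieldNormedType.Exports.
Export Order.TTheory GRing.Theory Num.Theory.

Set Implicit Arguments.
Unset Strict Implicit.
Unset Printing Implicit Defensive.

Local Open Scope classical_set_scope.
Local Open Scope ring_scope.

Definition half_line {R : realType} : set R := `[0, +oo[%classic.

(* The uniform structure of [subspace A] relates two distinct points only when
   both lie in A, so values of f off A play no role. *)
Definition unif_continuous_on {R : realType} (A : set R) (f : R -> R) : Prop :=
  unif_continuous (f : subspace A -> R).

(* Intervals with u i = v i are allowed; they contribute nothing to the sums. *)
Definition abs_continuous_on {R : realType} (c d : R) (f : R -> R) : Prop :=
  forall eps : R, 0 < eps -> exists2 delta : R, 0 < delta &
    forall (n : nat) (u v : 'I_n -> R),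
      (forall i, [/\ c <= u i, u i <= v i & v i <= d]) ->
      trivIset [set: 'I_n] (fun i => `](u i), (v i)[%classic) ->
      \sum_(i < n) (v i - u i) < delta ->
      \sum_(i < n) `|f (v i) - f (u i)| < eps.

(* x solves  x'(t) - a(t) x(g(t)) + b(t) x(h(t)) = 0  on [t0, +oo[  with initial
   function phi (on ]-oo, t0[) and initial value x0. *)
Definition is_solution {R : realType} (a b g h : R -> R) (t0 : R)
    (phi : R -> R) (x0 : R) (x : R -> R) : Prop :=
  [/\ forall c : R, t0 <= c -> abs_continuous_on t0 c x,
      {ae (@lebesgue_measure R), forall t : R, t0 <= t ->
         derivable x t 1 /\ 'D_1 x t - a t * x (g t) + b t * x (h t) = 0},
      forall t : R, t < t0 -> x t = phi t
    & x t0 = x0].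

Definition nonoscillatory {R : realType} (x : R -> R) : Prop :=
  exists T : R, forall t : R, T <= t -> x t != 0.

(* Main.v *)
Require Import Defs.
From mathcomp Require Import ring lra zify.
Local Open Scope classical_set_scope.
Local Open Scope ring_scope.

(** Why a positive solution exists.  Suppose first [b2 < a1] and look for a
    solution growing at a rate between [0] and [l], that is with
    [0 <= x' <= l x].  Such an [x] satisfies [x (g t) <= x t <= x (h t)], so

      [a x(g) - b x(h) <= (a2 - b1) x < l x]   as soon as [a2 - b1 < l],

    and [x (h t) <= exp (l (tau + sigma)) x (g t)], so that

      [a x(g) - b x(h) >= (a1 - b2 exp (l (tau + sigma))) x(g) > 0]

    as soon as [l (tau + sigma) < ln (a1 / b2)].  The smallness condition
    leaves room for such an [l].  Thus, for [x] in the convex cone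
    [0 <= x' <= l x], the growth rate prescribed by the equation lies strictly
    between [0] and [l].  As a map on growth rates this is decreasing and need
    not be a contraction, so the classical argument calls on Schauder's theorem.
    The linearity of the equation gives a more elementary route, in three steps.

    - Discretize with step [1 / N.+1] on an interval of length [N.+1].  This
      leaves a finite linear system for which one wants a solution in the cone
      [x i <= x i.+1 <= (1 + l) x i].  Deform the system linearly in a parameter
      [s], from an explicit geometric progression at [s = 0] to the system
      at [s = 1].  The kernel of the deformed system contains a nonzero vector
      polynomial in [s]; after division by common factors it vanishes for no
      [s].  The set of [s] in [[0, 1]] for which it lies in the cone is closed;
      it is also open, because a solution in the cone is automatically in its
      interior.
      By connectedness the curve stays in the cone up to [s = 1]: this is
      [slow_growth_solution].

    - If instead [a2 < b1], the solution decreases, and reading the grid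
      backwards exchanges delay and advance, hence also [a] and [b]:
      [decreasing_grid_solution] reduces to the same finite problem.

    - The grid solutions are bounded above and away from zero on bounded sets,
      and Lipschitz up to the step, uniformly in [N].  They converge pointwise
      along an ultrafilter, and the estimate comparing chords with the right-hand
      side, uniform in [N], passes to the limit and yields the derivative:
      this is [limit_of_grid_solutions].  The limit takes the
      value [1] before [t0], and satisfies the equation at every [t > t0]. *)

(** * Polynomial kernel vectors *)

(** If all entries vanish at some [s], dividing them by ['X - s] stays in the
    kernel and lowers the degree of the entry [j], so this stops. *)
Lemma kernel_curve_no_common_root {R : realType} {m n} (S : 'M[{poly R}]_(m, n))
    (v : 'cV[{poly R}]_n) (j : 'I_n) :
  S *m v = 0 -> v j 0 != 0 ->
  exists w : 'cV[{poly R}]_n, S *m w = 0 /\ forall s, exists i, (w i 0).[s] != 0.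
Proof.
have [k] := ubnP (size (v j 0)); elim: k v => // k IH v szv Sv0 vj0.
have [all_nz|/existsNP [s /forallNP vs0]] :=
    pselect (forall s, exists i, (v i 0).[s] != 0).
  by exists v.
have rootv i : root (v i 0) s by apply/negPn/negP/vs0.
pose w : 'cV[{poly R}]_n := \col_i (v i 0 %/ ('X - s%:P)).
have vE i : v i 0 = w i 0 * ('X - s%:P) by rewrite mxE divpK// dvdp_XsubCl.
have wj0 : w j 0 != 0 by apply: contra_neq vj0 => wj; rewrite vE wj mul0r.
apply: (IH w) => //.
  have : (size (w j 0%R) < size (v j 0%R))%N.
    by rewrite vE size_Mmonic ?monicXsubC// size_XsubC addn2.
  by move=> /leq_trans; apply.
apply/matrixP => a b; rewrite (ord1 b) [RHS]mxE.
apply: (mulIf (monic_neq0 (monicXsubC s))); rewrite mul0r.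
transitivity ((S *m v) a 0); last by rewrite Sv0 mxE.
rewrite [LHS]mulrC !mxE mulr_sumr; apply: eq_bigr => i _.
by rewrite vE; ring.
Qed.

(** The deformation joins the recurrence [x i.+1 = (1 + c) x i] at [s = 0] to the
    system of interest at [s = 1].  Complete the system by a row reading off
    [x 0]: the first column of the adjugate is then a kernel vector polynomial
    in [s], nonzero since at [s = 0] the completed matrix is unitriangular. *)
Lemma homotopy_kernel {R : realType} (n : nat) (A : nat -> nat -> R) (c : R) :
  exists x : nat -> {poly R},
    (forall s i, (i < n)%N ->
          (x i.+1).[s] - (x i).[s] = (1 - s) * (c * (x i).[s]) +
             s * \sum_(j < n.+1) A i j * (x j).[s])
    /\ forall s, exists2 i, (i <= n)%N & (x i).[s] != 0.
Proof.
pose q i j : {poly R} := ((j == i.+1)%:R - (1 + c) * (j == i)%:R)%:P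
   - 'X * (A i j - c * (j == i)%:R)%:P.
pose Q : 'M[{poly R}]_n.+1 := \matrix_(i, j)
  (if i == 0 :> nat then (j == 0 :> nat)%:R else q i.-1 j).
pose S : 'M[{poly R}]_(n, n.+1) := \matrix_(i, j) q i j.
have detQ0 : (\det Q).[0] = 1.
  rewrite -horner_evalE -det_map_mx det_trig.
    rewrite big1// => i _; rewrite !mxE -[LHS]/(_.[0]).
    case: eqP => [_|/eqP i0]; first by rewrite hornerE.
    rewrite /q prednK ?lt0n// eqxx.
    have -> : (i : nat) == i.-1 = false by lia.
    by rewrite !hornerE !subr0.
  apply/is_trig_mxP => i j ij; rewrite !mxE -[LHS]/(_.[0]).
  have -> : (j == 0 :> nat) = false by lia.
  case: ifPn => [_|i0]; first by rewrite hornerE.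
  rewrite /q prednK ?lt0n//.
  have -> : (j == i :> nat) = false by lia.
  have -> : (j : nat) == i.-1 = false by lia.
  by rewrite !hornerE !oppr0 addr0.
pose v := col 0 (\adj Q).
have Qv i : \sum_j Q i j * v j 0 = (\det Q) *+ (i == 0).
  have := mul_mx_adj Q => /matrixP /(_ i 0); rewrite !mxE => <-.
  by apply: eq_bigr => j _; rewrite !mxE.
have [w [Sw0 wnz]] : exists w : 'cV[{poly R}]_n.+1,
    S *m w = 0 /\ forall s, exists i, (w i 0).[s] != 0.
  apply: (@kernel_curve_no_common_root _ _ _ _ v 0).
    apply/matrixP => i j; rewrite (ord1 j) !mxE.
    rewrite -[RHS](Qv (lift ord0 i)); apply: eq_bigr => k _.
    by rewrite ![_ (lift ord0 i) _]mxE lift0 /= mxE.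
  have := Qv 0; rewrite (bigD1 0)//= big1 => [|j j0].
    rewrite addr0 mxE mul1r mulr1n => ->.
    by apply: contra_eq_neq detQ0 => ->; rewrite horner0 eq_sym oner_neq0.
  rewrite mxE /=; have -> : (j == 0 :> nat) = false by apply/negbTE.
  by rewrite mul0r.
exists (fun i => w (inord i) 0); split.
  move=> s i ltin; move/matrixP/(_ (Ordinal ltin) 0) : Sw0.
  rewrite !mxE => /(congr1 (horner^~ s)); rewrite horner0 horner_sum.
  under eq_bigr do rewrite mxE /q !hornerE /=.
  have sum_delta k : (k < n.+1)%N ->
      \sum_(j < n.+1) (j == k :> nat)%:R * (w j 0).[s] = (w (inord k) 0).[s].
    move=> kn; rewrite (bigD1 (inord k))//= inordK// eqxx mul1r big1 ?addr0//.
    move=> j jk; have -> : (j == k :> nat) = false; last by rewrite mul0r.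
    by apply: contraNF jk => /eqP <-; rewrite inord_val.
  rewrite (eq_bigr (fun j : 'I_n.+1 => (j == i.+1 :> nat)%:R * (w j 0).[s]
     - (1 + c - s * c) * ((j == i :> nat)%:R * (w j 0).[s])
     - s * (A i j * (w j 0).[s]))); last by move=> j _; ring.
  rewrite !sumrB -!mulr_sumr !sum_delta ?ltnS//; last exact: ltnW.
  under [\sum_(j < _) A i j * (w (inord j) 0).[s]]eq_bigr do rewrite inord_val.
  by lra.
move=> s; have [i wi] := wnz s; exists i; first by rewrite -ltnS.
by rewrite inord_val.
Qed.

(** * The finite problem in the cone of slowly growing sequences *)

Definition slow_growth {R : realType} (n : nat) (l : R) (x : nat -> R) : Prop :=
  forall i, (i < n)%N -> x i <= x i.+1 <= (1 + l) * x i.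

Lemma slow_growth_le {R : realType} n l (x : nat -> R) : slow_growth n l x ->
  forall i j, (i <= j <= n)%N -> x i <= x j.
Proof.
move=> xK i j /andP[]; elim: j => [|j IH]; first by rewrite leqn0 => /eqP ->.
rewrite leq_eqVlt ltnS => /orP[/eqP -> //|ij] jn.
by apply: le_trans (IH ij (ltnW jn)) _; have /andP[] := xK j jn.
Qed.

Lemma slow_growth_ub {R : realType} n l (x : nat -> R) : 0 <= l ->
  slow_growth n l x ->
  forall i j, (i <= j <= n)%N -> x j <= (1 + l) ^+ (j - i) * x i.
Proof.
move=> l0 xK i j /andP[]; elim: j => [|j IH].
  by rewrite leqn0 => /eqP ->; rewrite expr0 mul1r.
rewrite leq_eqVlt ltnS => /orP[/eqP -> _|ij jn].
  by rewrite subnn expr0 mul1r.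
have /andP[_ /le_trans] := xK j jn; apply.
rewrite subSn// exprS -mulrA; apply: ler_wpM2l; first exact: addr_ge0.
exact: IH ij (ltnW jn).
Qed.

Lemma closed_forall_le {R : realType} (n : nat) (f g : nat -> R -> R) :
  (forall i, continuous (f i)) -> (forall i, continuous (g i)) ->
  closed [set s | forall i, (i < n)%N -> f i s <= g i s].
Proof.
move=> fc gc.
have -> : [set s | forall i, (i < n)%N -> f i s <= g i s] =
    \bigcap_(i in [set i | (i < n)%N]) ((g i \- f i) @^-1` [set x | 0 <= x]).
  by apply/seteqP; split => s /= H i /H; rewrite /= subr_ge0.
apply: closed_bigI => i _; apply: preimage_closed; last exact: closed_ge.
by move=> s _; apply: cvgB; [exact: gc|exact: fc].
Qed.

Lemma open_forall_lt {R : realType} (n : nat) (f g : nat -> R -> R) :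
  (forall i, continuous (f i)) -> (forall i, continuous (g i)) ->
  open [set s | forall i, (i < n)%N -> f i s < g i s].
Proof.
move=> fc gc; elim: n => [|n IH].
  by rewrite [X in open X](_ : _ = setT); [exact: openT|apply/seteqP].
rewrite [X in open X](_ : _ = [set s | forall i, (i < n)%N -> f i s < g i s]
    `&` ((g n \- f n) @^-1` [set x | 0 < x])).
  apply: openI => //; apply: open_comp; last exact: open_gt.
  by move=> s _; apply: cvgB; [exact: gc|exact: fc].
apply/seteqP; split=> s /=.
  by move=> H; split=> [i /ltnW/H //|]; rewrite subr_gt0 H.
move=> [H]; rewrite subr_gt0 => Hn i; rewrite ltnS leq_eqVlt.
by move=> /orP[/eqP ->|/H].
Qed.

(** The finite-dimensional replacement for a fixed point theorem: a linear
    right-hand side that is strictly admissible on the whole cone has a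
    solution inside the cone. *)
Lemma slow_growth_solution {R : realType} (n : nat) (l : R) (A : nat -> nat -> R) :
  0 < l ->
  (forall x : nat -> R, slow_growth n l x -> 0 < x 0 ->
    forall i, (i < n)%N -> 0 < \sum_(j < n.+1) A i j * x j < l * x i) ->
  exists x : nat -> R, [/\ x 0 = 1, slow_growth n l x
    & forall i, (i < n)%N -> x i.+1 - x i = \sum_(j < n.+1) A i j * x j].
Proof.
move=> l0 Ain.
have [w [weq wnz]] := homotopy_kernel n A (l / 2).
(* At [s = 0] the curve is a geometric progression, so if its first entry
   vanished there, all of them would. *)
have w00 : (w 0).[0] != 0.
  apply/eqP => w00; have [i] := wnz 0.
  elim: i => [|i IH] ilt; first by rewrite w00 eqxx.
  have := weq 0 i ilt; rewrite mul0r addr0 subr0 mul1r => /eqP.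
  have -> : (w i).[0] = 0 by apply/eqP/negPn/negP/IH/ltnW.
  by rewrite mulr0 subr0 => ->.
pose y s i := (w i).[s] / (w 0).[0].
have ycont i : continuous (y ^~ i).
  by move=> s; apply: cvgMl; exact: continuous_horner.
have yeq s i : (i < n)%N -> y s i.+1 - y s i =
    (1 - s) * (l / 2 * y s i) + s * \sum_(j < n.+1) A i j * y s j.
  move=> ilt; rewrite /y -mulrBl weq// mulrDl; congr +%R; first by rewrite !mulrA.
  by rewrite -mulrA mulr_suml; congr *%R; apply: eq_bigr => j _; rewrite !mulrA.
have y00 : y 0 0 = 1 by rewrite /y divff.
(* [strict] is open, [weak] is closed, and they agree on [[0, 1]] because the
   increments of a solution in the cone are strictly between the bounds. *)
pose weak := [set s | [/\ 0 <= y s 0, forall i, (i < n)%N -> y s i <= y s i.+1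
  & forall i, (i < n)%N -> y s i.+1 <= (1 + l) * y s i]].
pose strict := [set s | [/\ 0 < y s 0, forall i, (i < n)%N -> y s i < y s i.+1
  & forall i, (i < n)%N -> y s i.+1 < (1 + l) * y s i]].
have ylcont i : continuous (fun s => (1 + l) * y s i).
  by move=> s; apply: cvgMr; exact: ycont.
have weakcl : closed weak.
  have -> : weak = ((y ^~ 0) @^-1` [set x | 0 <= x]) `&`
      ([set s | forall i, (i < n)%N -> y s i <= y s i.+1] `&`
       [set s | forall i, (i < n)%N -> y s i.+1 <= (1 + l) * y s i]).
    by apply/seteqP; split => s /=; [case=> ? ? ?; split|case=> ? [? ?]; split].
  by apply: closedI; [apply: preimage_closed; [move=> ? _; exact: ycont|exact: closed_ge]
    |apply: closedI; apply: closed_forall_le].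
have strictop : open strict.
  have -> : strict = ((y ^~ 0) @^-1` [set x | 0 < x]) `&`
      ([set s | forall i, (i < n)%N -> y s i < y s i.+1] `&`
       [set s | forall i, (i < n)%N -> y s i.+1 < (1 + l) * y s i]).
    by apply/seteqP; split => s /=; [case=> ? ? ?; split|case=> ? [? ?]; split].
  by apply: openI; [apply: open_comp; [move=> ? _; exact: ycont|exact: open_gt]
    |apply: openI; apply: open_forall_lt].
have weak_strict s : s \in `[0, 1] -> weak s -> strict s.
  rewrite in_itv /= => /andP[s0 s1] [y0 ylo yhi].
  have yK : slow_growth n l (y s) by move=> i ilt; rewrite ylo// yhi.
  (* In the cone, [y s 0 = 0] forces every entry to vanish, against the absence
     of common roots. *)
  have {}y0 : 0 < y s 0.
    rewrite lt_neqAle y0 andbT; apply/eqP => y0E; have [i ilt] := wnz s.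
    have yi : y s i = 0.
      apply/eqP; rewrite eq_le; apply/andP; split.
        have := slow_growth_ub _ _ _ (ltW l0) yK 0 i; rewrite -y0E mulr0.
        by apply.
      by rewrite y0E; apply: (slow_growth_le _ _ _ yK).
    move/eqP: yi; rewrite /y mulf_eq0 invr_eq0 (negbTE w00) orbF => ->.
    by [].
  have incr i : (i < n)%N -> 0 < y s i.+1 - y s i < l * y s i.
    move=> ilt; rewrite yeq//; have /andP[A0 Al] := Ain _ yK y0 i ilt.
    have yi0 : 0 < y s i.
      by apply: lt_le_trans y0 _; apply: (slow_growth_le _ _ _ yK); rewrite leq0n ltnW.
    have ly : 0 < l * y s i by rewrite mulr_gt0.
    set z := \sum_(j < _) _ in A0 Al *.
    rewrite (_ : l / 2 * y s i = (l * y s i) / 2); last by ring.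
    set u := l * y s i in Al ly *.
    have [->|sn0] := eqVneq s 0; first by apply/andP; split; lra.
    have sp : 0 < s by rewrite lt_neqAle eq_sym sn0.
    have := mulr_gt0 sp A0; have : 0 < s * (u - z) by rewrite mulr_gt0 ?subr_gt0.
    have : 0 <= (1 - s) * u by rewrite mulr_ge0 ?subr_ge0 // ltW.
    by move=> *; apply/andP; split; lra.
  split=> // i /incr /andP[]; first by rewrite subr_gt0.
  by rewrite mulrDl mul1r ltrBlDl.
have strict_weak s : strict s -> weak s.
  by move=> [? H1 H2]; split=> [|i /H1/ltW|i /H2/ltW]; first exact: ltW.
have strict0 : strict 0.
  have step i : (i < n)%N -> y 0 i.+1 = (1 + l / 2) * y 0 i.
    by move=> /(yeq 0); rewrite subr0 mul1r mul0r addr0 => e; lra.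
  have ypos i : (i <= n)%N -> 0 < y 0 i.
    elim: i => [|i IH] ilt; first by rewrite y00.
    by rewrite step// mulr_gt0 ?IH 1?ltnW// addr_gt0 ?divr_gt0.
  split=> [|i ilt|i ilt]; first by rewrite y00.
    by have := ypos i (ltnW ilt); rewrite step// => yi; nra.
  by have := ypos i (ltnW ilt); rewrite step// => yi; nra.
have /(_ (`[0, 1] `&` strict)) full := @segment_connected R 0 1.
have [_ {}strict1] : (`[0, 1] `&` strict) 1.
  rewrite full; first by rewrite /= in_itv /= ler01 lexx.
  - by exists 0; split => //; rewrite /= in_itv /= lexx ler01.
  - by exists strict.
  - exists weak => //; apply/seteqP; split=> s [s01 Hs]; split=> //.
      exact: strict_weak.
    exact: weak_strict.
have [y0 ylo yhi] := strict1.
exists (fun i => y 1 i / y 1 0); split.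
- by rewrite divff// gt_eqF.
- move=> i ilt /=; apply/andP; rewrite mulrA.
  rewrite (ler_pM2r (_ : 0 < (y 1 0)^-1)) ?invr_gt0//.
  rewrite (ler_pM2r (_ : 0 < (y 1 0)^-1)) ?invr_gt0//.
  by split; apply: ltW; [exact: ylo|exact: yhi].
- move=> i ilt; rewrite -mulrBl yeq// subrr mul0r add0r mul1r mulr_suml.
  by apply: eq_bigr => j _; rewrite -mulrA.
Qed.

(** * The discretized equation *)

(** The cone estimates explained at the top, on a grid: [P j] is the delayed index and
    [Q j] the advanced one.  The same statement serves both signs of
    [a - b]: for a decreasing solution [alpha] comes from [b] and [beta] from [a],
    indices being counted from the end of the grid. *)
Lemma mixed_growth_solution {R : realType} (n : nat) (d l A1 A2 B1 B2 : R)
    (alpha beta : nat -> R) (P Q : nat -> nat) :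
  0 < d -> 0 < l -> 0 < A1 -> 0 < B1 -> A2 - B1 < l ->
  (forall j, (j < n)%N -> (P j <= j <= Q j)%N /\ (Q j <= n)%N) ->
  (forall j, (j < n)%N -> A1 <= alpha j <= A2 /\ B1 <= beta j <= B2) ->
  (forall j, (j < n)%N -> (1 + d * l) ^+ (Q j - P j) * B2 < A1) ->
  exists y : nat -> R, [/\ y 0 = 1, slow_growth n (d * l) y
    & forall j, (j < n)%N ->
        y j.+1 - y j = d * (alpha j * y (P j) - beta j * y (Q j))].
Proof.
move=> d0 l0 A10 B10 ABl PQ ab grow.
pose A i j : R := d * (alpha i * (j == P i)%:R - beta i * (j == Q i)%:R).
have AE (y : nat -> R) i : (i < n)%N -> \sum_(j < n.+1) A i j * y j =
    d * (alpha i * y (P i) - beta i * y (Q i)).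
  move=> ilt; have [/andP[Pi iQ] Qn] := PQ i ilt.
  have sum_delta k : (k <= n)%N -> \sum_(j < n.+1) (j == k :> nat)%:R * y j = y k.
    move=> kn; rewrite (bigD1 (Ordinal (kn : k < n.+1)%N))//= eqxx mul1r.
    rewrite big1 ?addr0// => j jk.
    by rewrite (_ : (j == k :> nat) = false) ?mul0r//; apply: contraNF jk.
  rewrite -[in RHS](sum_delta (P i)) -?[in RHS](sum_delta (Q i))//; last by lia.
  rewrite !mulr_sumr -sumrB mulr_sumr; apply: eq_bigr => j _.
  by rewrite /A; ring.
have [y [y0 yK yeq]] : exists x : nat -> R, [/\ x 0 = 1, slow_growth n (d * l) x
    & forall i, (i < n)%N -> x i.+1 - x i = \sum_(j < n.+1) A i j * x j].
  apply: slow_growth_solution => [|y yK y0 i ilt]; first exact: mulr_gt0.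
  rewrite AE//; have [/andP[Pi iQ] Qn] := PQ i ilt.
  have [/andP[a1 a2] /andP[b1 b2]] := ab i ilt.
  have yP : y (P i) <= y i.
    by apply: (slow_growth_le _ _ _ yK); rewrite Pi ltnW.
  have yQ : y i <= y (Q i).
    by apply: (slow_growth_le _ _ _ yK); rewrite iQ.
  have yPQ : y (Q i) <= (1 + d * l) ^+ (Q i - P i) * y (P i).
    apply: (slow_growth_ub _ _ _ _ yK); first by rewrite ltW ?mulr_gt0.
    by rewrite (leq_trans Pi iQ).
  have yP0 : 0 < y (P i).
    apply: lt_le_trans y0 _; apply: (slow_growth_le _ _ _ yK).
    by rewrite leq0n (leq_trans Pi (ltnW ilt)).
  set u := y i in yP yQ *; set p := y (P i) in yP yPQ yP0 *.
  set q := y (Q i) in yQ yPQ *; have := grow i ilt; set w := _ ^+ _ in yPQ *.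
  move=> wB; rewrite -mulrA ltr_pM2l// pmulr_rgt0//.
  have u0 : 0 < u by lra.
  have q0 : 0 < q by lra.
  have a0 : 0 < alpha i by lra.
  have b0 : 0 < beta i by lra.
  apply/andP; split; rewrite ?subr_gt0.
    have h1 : beta i * q <= B2 * q by rewrite ler_wpM2r // ltW.
    have h2 : B2 * q <= B2 * (w * p) by rewrite ler_wpM2l //; lra.
    have h3 : w * B2 * p < A1 * p by rewrite ltr_pM2r.
    have h4 : A1 * p <= alpha i * p by rewrite ler_wpM2r // ltW.
    by lra.
  have h1 : alpha i * p <= A2 * u.
    apply: (le_trans (y := alpha i * u)); first by rewrite ler_wpM2l// ltW.
    by rewrite ler_wpM2r// ltW.
  have h2 : B1 * u <= beta i * q.
    apply: (le_trans (y := beta i * u)); first by rewrite ler_wpM2r// ltW.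
    by rewrite ler_wpM2l// ltW.
  have h3 : (A2 - B1) * u < l * u by rewrite ltr_pM2r.
  by lra.
by exists y; split => // j jn; rewrite yeq// AE.
Qed.

(** With step [1 / N.+1], this many steps cover an interval of length [N.+1]: as
    [N] grows, the mesh tends to zero and the horizon to infinity. *)
Definition grid_length (N : nat) : nat := (N.+1 * N.+1)%N.

Definition grid_node {R : realType} (t0 : R) (N i : nat) : R :=
  t0 + i%:R / N.+1%:R.

(** The last node not after [t], clamped to the grid at both ends: every time up to
    [t0] is sent to index [0], which makes the initial function constant. *)
Definition grid_index {R : realType} (t0 : R) (N : nat) (t : R) : nat :=
  minn (grid_length N) (Num.truncn ((t - t0) * N.+1%:R)).

Lemma grid_index_node {R : realType} (t0 : R) N i :
  (i <= grid_length N)%N -> grid_index t0 N (grid_node t0 N i) = i.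
Proof.
move=> ile; rewrite /grid_index /grid_node addrC addKr divfK ?pnatr_eq0//.
by rewrite natrK; apply/minn_idPr.
Qed.

Lemma le_grid_index {R : realType} (t0 : R) N s t :
  s <= t -> (grid_index t0 N s <= grid_index t0 N t)%N.
Proof.
move=> st; rewrite /grid_index.
have : (Num.truncn ((s - t0) * N.+1%:R) <= Num.truncn ((t - t0) * N.+1%:R))%N.
  by apply: le_truncn; rewrite ler_wpM2r// lerD2r.
by lia.
Qed.

Lemma grid_index_le {R : realType} (t0 : R) N t :
  t0 <= t -> (grid_index t0 N t)%:R <= (t - t0) * N.+1%:R.
Proof.
move=> t0t; apply: (le_trans (y := (Num.truncn ((t - t0) * N.+1%:R))%:R)).
  by rewrite ler_nat geq_minr.
by rewrite truncn_le mulr_ge0// subr_ge0.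
Qed.

Lemma grid_index_gt {R : realType} (t0 : R) N t :
  t < t0 + N.+1%:R -> (t - t0) * N.+1%:R < (grid_index t0 N t)%:R + 1.
Proof.
move=> tN; have [tt0|t0t] := ltP t t0.
  apply: (lt_le_trans (y := 0)); last by rewrite addr_ge0.
  by rewrite nmulr_rlt0// subr_lt0.
have tN2 : (t - t0) * N.+1%:R < (grid_length N)%:R.
  by rewrite natrM ltr_pM2r// ltrBlDl.
have t00 : 0 <= (t - t0) * N.+1%:R by rewrite mulr_ge0// subr_ge0.
rewrite /grid_index (minn_idPr _).
  by rewrite natr1; have /andP[] := truncn_itv t00.
by apply: ltnW; rewrite truncn_lt_nat.
Qed.

Lemma grid_index_before {R : realType} (t0 : R) N t :
  t <= t0 -> grid_index t0 N t = 0%N.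
Proof.
move=> tt0; apply/eqP; rewrite -leqn0 -[leqRHS](@grid_index_node _ t0 N)//.
by apply: le_grid_index; rewrite /grid_node mul0r addr0.
Qed.

(** Rounding costs at most one step; this is why the growth rate is chosen
    with [l (tau + sigma + 1 / N.+1)], and not only [l (tau + sigma)], below the
    logarithm. *)
Lemma grid_index_span {R : realType} (t0 : R) N s t : s <= t ->
  (grid_index t0 N t - grid_index t0 N s)%:R <= (t - s) * N.+1%:R + 1.
Proof.
move=> st; have st0 : 0 <= (t - s) * N.+1%:R by rewrite mulr_ge0 ?subr_ge0.
have [tt0|t0t] := leP t t0.
  by rewrite (grid_index_before _ _ _ tt0) sub0n addr_ge0.
have [sN|Ns] := ltP s (t0 + N.+1%:R).
  have := grid_index_gt t0 N s sN; have := grid_index_le t0 N t (ltW t0t).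
  by rewrite natrB ?le_grid_index// => *; lra.
rewrite (_ : (_ - _)%N = 0%N) ?addr_ge0//.
apply/eqP; rewrite subn_eq0 [leqRHS](minn_idPl _) ?geq_minl//.
have N0 := ler0n R N.+1.
rewrite truncn_ge_nat; last by rewrite mulr_ge0// subr_ge0; lra.
by rewrite natrM ler_wpM2r// lerBrDl.
Qed.

Lemma grid_index_span_ge {R : realType} (t0 : R) N s t :
  t0 <= s -> s <= t -> t < t0 + N.+1%:R ->
  (t - s) * N.+1%:R - 1 <= (grid_index t0 N t - grid_index t0 N s)%:R.
Proof.
move=> t0s st tN; rewrite natrB ?le_grid_index//.
by have := grid_index_gt t0 N t tN; have := grid_index_le t0 N s t0s; lra.
Qed.

(** The offset [e] distinguishes the explicit scheme ([e = 0], increasing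
    solutions) from the one sampled at the right end of each step
    ([e = 1], produced by reading an explicit scheme backwards).  The two-sided
    ratio bound covers increasing and decreasing solutions alike. *)
Definition grid_solution {R : realType} (a b g h : R -> R) (t0 l : R) (N : nat)
    (x : nat -> R) : Prop :=
  let F t := a t * x (grid_index t0 N (g t)) - b t * x (grid_index t0 N (h t)) in
  [/\ x 0 = 1, forall i, (i <= grid_length N)%N -> 0 < x i,
    forall i, (i < grid_length N)%N ->
      x i <= (1 + N.+1%:R^-1 * l) * x i.+1 /\ x i.+1 <= (1 + N.+1%:R^-1 * l) * x i
  & exists2 e, (e <= 1)%N & forall i, (i < grid_length N)%N ->
      x i.+1 - x i = N.+1%:R^-1 * F (grid_node t0 N (i + e))].

(** [l] is taken half-way between [K] and [L / s]; the remaining room absorbs the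
    rounding term for a fine enough mesh. *)
Lemma rate_exists {R : realType} (K s L : R) : 0 <= K -> 0 < s -> K < s^-1 * L ->
  exists2 l, 0 < l /\ K < l &
    exists N0, forall N, (N0 <= N)%N -> l * (s + N.+1%:R^-1) < L.
Proof.
move=> K0 s0 KL; pose l := (K + s^-1 * L) / 2.
have l0 : 0 < l by rewrite /l; lra.
have lL : 0 < L - l * s.
  have -> : L = (s^-1 * L) * s by rewrite mulrAC mulVf ?mul1r// gt_eqF.
  by rewrite -mulrBl mulr_gt0//; rewrite /l; lra.
exists l; first by split => //; rewrite /l; lra.
exists (Num.bound (l / (L - l * s))) => N N0N.
rewrite mulrDr -ltrBrDl ltr_pdivrMr ?ltr0n// mulrC -ltr_pdivrMr//.
apply: lt_le_trans (_ : (Num.bound (l / (L - l * s)))%:R <= _); last by rewrite ler_nat ltnW.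
by apply: archi_boundP; rewrite divr_ge0 ?ltW.
Qed.

(** Growth over a window of [k] steps, compared with the exponential by
    [1 + u <= exp u]. *)
Lemma compound_growth_lt {R : realType} (l s A B : R) (N k : nat) :
  0 < l -> 0 < A -> 0 < B -> l * (s + N.+1%:R^-1) < ln (A / B) ->
  k%:R <= s * N.+1%:R + 1 -> (1 + N.+1%:R^-1 * l) ^+ k * B < A.
Proof.
move=> l0 A0 B0 lL ks; rewrite -ltr_pdivlMr//.
have d0 : 0 < N.+1%:R^-1 :> R by rewrite invr_gt0.
rewrite -[ltRHS](@lnK R) ?posrE ?divr_gt0//.
apply: le_lt_trans (_ : _ <= expR (N.+1%:R^-1 * l) ^+ k) _.
  by rewrite lerXn2r ?nnegrE ?addr_ge0 ?mulr_ge0 ?expR_ge0 ?expR_ge1Dx// ltW.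
rewrite -expRM_natl ltr_expR; apply: le_lt_trans lL.
apply: (le_trans (y := (s * N.+1%:R + 1) * (N.+1%:R^-1 * l))).
  by rewrite ler_wpM2r// mulr_ge0// ltW.
rewrite (_ : _ * _ = (s * (N.+1%:R * N.+1%:R^-1) + N.+1%:R^-1) * l); last by ring.
by rewrite mulfV ?pnatr_eq0// mulr1 mulrC.
Qed.

Lemma slow_growth_backward {R : realType} n l (x : nat -> R) : 0 <= l ->
  0 < x 0 -> slow_growth n l x ->
  forall i, (i < n)%N -> x i <= (1 + l) * x i.+1.
Proof.
move=> l0 x0 xK i ilt; have /andP[xi _] := xK i ilt.
have xi0 : 0 <= x i.+1.
  by apply: le_trans (ltW x0) _; apply: (slow_growth_le _ _ _ xK); lia.
by apply: le_trans xi _; rewrite ler_peMl// lerDl.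
Qed.

Lemma grid_node_ge {R : realType} (t0 : R) N i : t0 <= grid_node t0 N i.
Proof. by rewrite lerDl divr_ge0. Qed.

Lemma grid_delay_advance {R : realType} (g h : R -> R) (t0 tau sigma : R) :
  (forall t, t0 <= t -> g t <= t <= h t) ->
  (forall t, t0 <= t -> t - g t <= tau /\ h t - t <= sigma) ->
  forall N i, (i <= grid_length N)%N ->
  let p := grid_index t0 N (g (grid_node t0 N i)) in
  let q := grid_index t0 N (h (grid_node t0 N i)) in
  [/\ (p <= i <= q)%N, (q <= grid_length N)%N
    & (q - p)%:R <= (tau + sigma) * N.+1%:R + 1].
Proof.
move=> gh gh_delay N i ile /=; set t := grid_node t0 N i.
have t0t : t0 <= t := grid_node_ge t0 N i.
have /andP[gt th] := gh t t0t; have [gtau hsigma] := gh_delay t t0t.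
split; last 2 first.
- exact: geq_minl.
- apply: le_trans (grid_index_span t0 N _ _ (le_trans gt th)) _.
  by rewrite lerD2r ler_wpM2r//; lra.
by rewrite -{1 2}(grid_index_node t0 N i ile) !le_grid_index.
Qed.

Lemma increasing_grid_solution {R : realType} (a b g h : R -> R)
    (t0 a1 a2 b1 b2 tau sigma : R) :
  0 < a1 -> 0 < b1 -> 0 < b2 -> 0 < tau -> 0 < sigma ->
  (forall t, t0 <= t -> a1 <= a t <= a2 /\ b1 <= b t <= b2) ->
  (forall t, t0 <= t -> g t <= t <= h t) ->
  (forall t, t0 <= t -> t - g t <= tau /\ h t - t <= sigma) ->
  0 < a2 - b1 < (tau + sigma)^-1 * ln (a1 / b2) ->
  exists2 l, 0 < l & exists N0, forall N, (N0 <= N)%N ->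
    exists x, grid_solution a b g h t0 l N x.
Proof.
move=> a10 b10 b20 tau0 sigma0 ab gh gh_delay /andP[K0 KL].
have [l [l0 Kl] [N0 lL]] := rate_exists _ _ _ (ltW K0) (addr_gt0 tau0 sigma0) KL.
exists l => //; exists N0 => N N0N.
have d0 : 0 < N.+1%:R^-1 :> R by rewrite invr_gt0.
have grid := grid_delay_advance g h t0 tau sigma gh gh_delay N.
pose t i := grid_node t0 N i.
have [y [y0 yK yeq]] := mixed_growth_solution (grid_length N) N.+1%:R^-1 l a1 a2 b1 b2
  (a \o t) (b \o t) (fun i => grid_index t0 N (g (t i)))
  (fun i => grid_index t0 N (h (t i))) d0 l0 a10 b10 Kl
  (fun j jn => let: And3 pq qn _ := grid j (ltnW jn) in conj pq qn)
  (fun j _ => ab (t j) (grid_node_ge t0 N j))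
  (fun j jn => let: And3 _ _ k := grid j (ltnW jn) in
     compound_growth_lt l _ _ _ _ _ l0 a10 b20 (lL N N0N) k).
have l'0 : 0 <= N.+1%:R^-1 * l by rewrite mulr_ge0 ?ltW.
exists y; split => //.
- move=> i ile; apply: lt_le_trans (_ : y 0 <= _); first by rewrite y0.
  exact: (slow_growth_le _ _ _ yK).
- move=> i ilt; have /andP[] := yK i ilt; split => //.
  by apply: (slow_growth_backward _ _ _ l'0 _ yK) => //; rewrite y0.
- by exists 0%N => // i /yeq ->; rewrite addn0.
Qed.

Lemma rev_between (n j p q : nat) : (j <= n)%N -> (p <= n - j <= q)%N ->
  (q <= n)%N -> (n - q <= j <= n - p)%N.
Proof. lia. Qed.

Lemma subn_rev (n p q : nat) : (q <= n)%N -> (n - p - (n - q) = q - p)%N.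
Proof. lia. Qed.

(** Reading the grid from its end turns a decreasing solution into an
    increasing one, the advanced argument into a delayed one, and exchanges
    [a] and [b].  The value [1] at the start of the grid is recovered by scaling. *)
Lemma decreasing_grid_solution {R : realType} (a b g h : R -> R)
    (t0 a1 a2 b1 b2 tau sigma : R) :
  0 < a1 -> 0 < a2 -> 0 < b1 -> 0 < tau -> 0 < sigma ->
  (forall t, t0 <= t -> a1 <= a t <= a2 /\ b1 <= b t <= b2) ->
  (forall t, t0 <= t -> g t <= t <= h t) ->
  (forall t, t0 <= t -> t - g t <= tau /\ h t - t <= sigma) ->
  0 < b2 - a1 < (tau + sigma)^-1 * ln (b1 / a2) ->
  exists2 l, 0 < l & exists N0, forall N, (N0 <= N)%N ->
    exists x, grid_solution a b g h t0 l N x.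
Proof.
move=> a10 a20 b10 tau0 sigma0 ab gh gh_delay /andP[K0 KL].
have [l [l0 Kl] [N0 lL]] := rate_exists _ _ _ (ltW K0) (addr_gt0 tau0 sigma0) KL.
exists l => //; exists N0 => N N0N.
have d0 : 0 < N.+1%:R^-1 :> R by rewrite invr_gt0.
have grid := grid_delay_advance g h t0 tau sigma gh gh_delay N.
pose n := grid_length N.
pose t j := grid_node t0 N (n - j).
pose p j := grid_index t0 N (g (t j)); pose q j := grid_index t0 N (h (t j)).
have pq j : (j < n)%N -> [/\ (n - q j <= j <= n - p j)%N, (n - p j <= n)%N
    & ((n - p j) - (n - q j))%:R <= (tau + sigma) * N.+1%:R + 1 :> R].
  move=> jn; have [/andP[pj jq] qn k] := grid (n - j)%N (leq_subr _ _).
  rewrite -/(t j) -/(p j) -/(q j) -/n in pj jq qn k.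
  split; [by apply: rev_between (ltnW jn) _ qn; rewrite pj|exact: leq_subr|].
  by rewrite subn_rev.
have [y [y0 yK yeq]] := mixed_growth_solution n N.+1%:R^-1 l b1 b2 a1 a2
  (b \o t) (a \o t) (fun j => n - q j)%N (fun j => n - p j)%N d0 l0 b10 a10 Kl
  (fun j jn => let: And3 pq qn _ := pq j jn in conj pq qn)
  (fun j _ => let: conj aj bj := ab (t j) (grid_node_ge t0 N _) in conj bj aj)
  (fun j jn => let: And3 _ _ k := pq j jn in
     compound_growth_lt l _ _ _ _ _ l0 b10 a20 (lL N N0N) k).
have l'0 : 0 <= N.+1%:R^-1 * l by rewrite mulr_ge0 ?ltW.
have ypos j : (j <= n)%N -> 0 < y j.
  move=> jn; apply: lt_le_trans (_ : y 0 <= _); first by rewrite y0.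
  exact: (slow_growth_le _ _ _ yK).
have yn0 : 0 < y n by exact: ypos.
exists (fun i => y (n - i)%N / y n); split => //.
- by rewrite subn0 divff// gt_eqF.
- by move=> i ile; rewrite divr_gt0 ?ypos// leq_subr.
- move=> i ilt; have jn : (n - i.+1 < n)%N by rewrite ltn_subrL.
  rewrite -(subnSK ilt).
  rewrite !mulrA !ler_pM2r ?invr_gt0//; split; first by have /andP[] := yK _ jn.
  by apply: (slow_growth_backward _ _ _ l'0 _ yK) => //; rewrite y0.
- exists 1%N => // i ilt; have jn : (n - i.+1 < n)%N by rewrite ltn_subrL.
  have := yeq _ jn; rewrite /= /p /q /t (subKn ilt) addn1 (subnSK ilt) => e.
  rewrite -mulrBl -opprB e; ring.
Qed.

(** * Estimates uniform in the mesh *)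

Lemma telescope_linear {R : realType} (x : nat -> R) (d D E : R) (k m : nat) :
  (k <= m)%N ->
  (forall i, (k <= i < m)%N -> `|x i.+1 - x i - d * D| <= d * E) ->
  `|x m - x k - (m - k)%:R * (d * D)| <= (m - k)%:R * (d * E).
Proof.
move=> km; elim: m km => [|m IH] km step.
  by move: km; rewrite leqn0 => /eqP ->; rewrite subnn !mul0r !subrr normr0.
move: km; rewrite leq_eqVlt ltnS => /orP[/eqP <-|km].
  by rewrite subnn !mul0r !subrr normr0.
rewrite subSn// -natr1 !mulrDl !mul1r.
have -> : x m.+1 - x k - ((m - k)%:R * (d * D) + d * D) =
  (x m - x k - (m - k)%:R * (d * D)) + (x m.+1 - x m - d * D) by ring.
apply: (le_trans (ler_normD _ _)); apply: lerD.
  by apply: IH => // i /andP[ki im]; apply: step; rewrite ki ltnW.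
by apply: step; rewrite km ltnSn.
Qed.

Definition grid_interp {R : realType} (t0 : R) (N : nat) (x : nat -> R) (t : R) : R :=
  x (grid_index t0 N t).

Lemma grid_node_le_expR {R : realType} (t0 l : R) N t i :
  0 < l -> t0 <= t -> (i <= grid_index t0 N t)%N ->
  expR (N.+1%:R^-1 * l) ^+ i <= expR (l * (t - t0)).
Proof.
move=> l0 t0t it; rewrite -expRM_natl ler_expR mulrA -[leRHS]mulrC ler_pM2r//.
rewrite ler_pdivrMr//; apply: le_trans (grid_index_le _ N _ t0t).
by rewrite ler_nat.
Qed.

Lemma grid_solution_bounds {R : realType} (a b g h : R -> R) (t0 l : R) N x :
  0 < l -> grid_solution a b g h t0 l N x ->
  forall i, (i <= grid_length N)%N ->
    (expR (N.+1%:R^-1 * l) ^+ i)^-1 <= x i <= expR (N.+1%:R^-1 * l) ^+ i.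
Proof.
move=> l0 [x0 xpos xstep _]; set q := expR _.
have dl0 : 0 <= N.+1%:R^-1 * l by rewrite mulr_ge0 ?ltW.
have q0 : 0 < q by exact: expR_gt0.
have q1 : 1 + N.+1%:R^-1 * l <= q by exact: expR_ge1Dx.
elim=> [|i IH] ilt; first by rewrite x0 expr0 invr1 lexx.
have /andP[lo hi] := IH (ltnW ilt); have [back forw] := xstep i ilt.
have xi := xpos i (ltnW ilt); have xi1 := xpos i.+1 ilt.
rewrite exprS invfM; apply/andP; split.
  rewrite ler_pdivrMl//; apply: le_trans lo _; apply: le_trans back _.
  by rewrite ler_wpM2r// ltW.
apply: le_trans forw _; apply: (le_trans (y := q * x i)).
  by rewrite ler_wpM2r// ltW.
by rewrite ler_wpM2l// ltW.
Qed.

Lemma grid_interp_le {R : realType} (a b g h : R -> R) (t0 l : R) N x :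
  0 < l -> grid_solution a b g h t0 l N x ->
  forall c t, t0 <= c -> t <= c -> 0 < grid_interp t0 N x t <= expR (l * (c - t0)).
Proof.
move=> l0 xS c t t0c tc; have [_ xpos _ _] := xS.
rewrite xpos ?geq_minl//=.
have /andP[_] := grid_solution_bounds _ _ _ _ _ _ _ _ l0 xS (grid_index t0 N t) (geq_minl _ _).
move=> /le_trans; apply; apply: grid_node_le_expR => //.
exact: le_grid_index.
Qed.

Lemma grid_interp_ge {R : realType} (a b g h : R -> R) (t0 l : R) N x :
  0 < l -> grid_solution a b g h t0 l N x ->
  forall t, t0 <= t -> (expR (l * (t - t0)))^-1 <= grid_interp t0 N x t.
Proof.
move=> l0 xS t t0t.
have /andP[lo _] := grid_solution_bounds _ _ _ _ _ _ _ _ l0 xS (grid_index t0 N t) (geq_minl _ _).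
apply: le_trans lo.
by rewrite lef_pV2 ?posrE ?exprn_gt0 ?expR_gt0// grid_node_le_expR.
Qed.

(** Piecewise constant interpolants are Lipschitz only up to one mesh step. *)
Lemma grid_interp_lipschitz {R : realType} (a b g h : R -> R) (t0 l : R) N x :
  0 < l -> grid_solution a b g h t0 l N x ->
  forall c s t, t0 <= c -> s <= t -> t <= c ->
  `|grid_interp t0 N x t - grid_interp t0 N x s| <=
    l * expR (l * (c - t0)) * ((t - s) + N.+1%:R^-1).
Proof.
move=> l0 xS c s t t0c st tc; set M := expR _.
have d0 : 0 < N.+1%:R^-1 :> R by rewrite invr_gt0.
have [_ xpos xstep _] := xS.
have M0 : 0 < M by exact: expR_gt0.
have xM i : (i <= grid_index t0 N c)%N -> x i <= M.
  move=> ic; have iN : (i <= grid_length N)%N := leq_trans ic (geq_minl _ _).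
  have /andP[_] := grid_solution_bounds _ _ _ _ _ _ _ _ l0 xS i iN.
  by move=> /le_trans; apply; apply: grid_node_le_expR.
have step i : (grid_index t0 N s <= i < grid_index t0 N t)%N ->
    `|x i.+1 - x i - N.+1%:R^-1 * 0| <= N.+1%:R^-1 * (l * M).
  move=> /andP[si it]; rewrite mulr0 subr0.
  have ic : (i < grid_index t0 N c)%N := leq_trans it (le_grid_index t0 N _ _ tc).
  have ilt : (i < grid_length N)%N := leq_trans ic (geq_minl _ _).
  have [back forw] := xstep i ilt; have := xM _ ic; have := xM _ (ltnW ic).
  move=> xi xi1; rewrite mulrA ler_norml.
  have dl0 : 0 <= N.+1%:R^-1 * l by rewrite mulr_ge0 ?ltW.
  have := ler_wpM2l dl0 xi; have := ler_wpM2l dl0 xi1.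
  move: back forw; rewrite !mulrDl !mul1r.
  set u := N.+1%:R^-1 * l; move: (u * M) (u * x i) (u * x i.+1).
  by move=> *; apply/andP; split; lra.
have := telescope_linear _ _ _ _ _ _ (le_grid_index t0 N _ _ st) step.
rewrite !mulr0 subr0 => /le_trans; apply.
apply: (le_trans (y := ((t - s) * N.+1%:R + 1) * (N.+1%:R^-1 * (l * M)))).
  by rewrite ler_wpM2r ?grid_index_span// !mulr_ge0 ?ltW.
rewrite (_ : _ * _ = l * M * ((t - s) * (N.+1%:R * N.+1%:R^-1) + N.+1%:R^-1)).
  by rewrite mulfV ?pnatr_eq0// mulr1.
by ring.
Qed.

(** When the right-hand side stays within [E] of [D] at all nodes used between
    [s] and [t], the chord has slope close to [D].  The nodes may precede [s] by
    less than one step, hence the enlarged range for [r]; the last term is the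
    rounding of [t - s] to a whole number of steps. *)
Lemma grid_interp_linear {R : realType} (a b g h : R -> R) (t0 l : R) N x :
  grid_solution a b g h t0 l N x ->
  forall s t D E, t0 <= s -> s <= t -> t < t0 + N.+1%:R -> 0 <= E ->
  (forall r, t0 <= r -> s - N.+1%:R^-1 <= r <= t ->
     `|a r * grid_interp t0 N x (g r) - b r * grid_interp t0 N x (h r) - D| <= E) ->
  `|grid_interp t0 N x t - grid_interp t0 N x s - (t - s) * D| <=
    ((t - s) + N.+1%:R^-1) * E + N.+1%:R^-1 * `|D|.
Proof.
move=> [_ _ _ [e e1 xeq]] s t D E t0s st tN E0 FE.
have d0 : 0 < N.+1%:R^-1 :> R by rewrite invr_gt0.
have Nd : N.+1%:R * N.+1%:R^-1 = 1 :> R by rewrite mulfV ?pnatr_eq0.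
set d := N.+1%:R^-1 in d0 Nd xeq FE *.
set k := grid_index t0 N s; set m := grid_index t0 N t.
have km : (k <= m)%N := le_grid_index t0 N _ _ st.
have lin : `|x m - x k - (m - k)%:R * (d * D)| <= (m - k)%:R * (d * E).
  apply: telescope_linear => // i /andP[ki im].
  have ilt : (i < grid_length N)%N := leq_trans im (geq_minl _ _).
  rewrite xeq// -mulrBr normrM (gtr0_norm d0) ler_pM2l//.
  apply: FE; first exact: grid_node_ge.
  rewrite /grid_node -/d; apply/andP; split.
    have := grid_index_gt t0 N s (le_lt_trans st tN); rewrite -/k => sk.
    have kie : k%:R <= (i + e)%:R :> R by rewrite ler_nat; lia.
    have : (s - t0) * N.+1%:R * d < (k%:R + 1) * d by rewrite ltr_pM2r.
    have := ler_wpM2r (ltW d0) kie.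
    by rewrite -mulrA Nd; lra.
  have := grid_index_le t0 N t (le_trans t0s st); rewrite -/m => mt.
  have iem : (i + e)%:R <= m%:R :> R by rewrite ler_nat; lia.
  have := ler_wpM2r (ltW d0) mt; rewrite -mulrA Nd mulr1.
  by have := ler_wpM2r (ltW d0) iem; lra.
have up : (m - k)%:R * d <= (t - s) + d.
  have := ler_wpM2r (ltW d0) (grid_index_span t0 N _ _ st); rewrite -/k -/m.
  by rewrite mulrDl mul1r -mulrA Nd mulr1.
have lo : (t - s) - d <= (m - k)%:R * d.
  have := ler_wpM2r (ltW d0) (grid_index_span_ge t0 N _ _ t0s st tN); rewrite -/k -/m.
  by rewrite mulrBl mul1r -mulrA Nd mulr1.
rewrite /grid_interp -/k -/m.
have -> : x m - x k - (t - s) * D =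
  (x m - x k - (m - k)%:R * (d * D)) + ((m - k)%:R * d - (t - s)) * D by ring.
apply: (le_trans (ler_normD _ _)); apply: lerD.
  by apply: le_trans lin _; rewrite mulrA ler_wpM2r.
by rewrite normrM ler_wpM2r// ler_norml; apply/andP; split; lra.
Qed.

(** * Passage to the limit *)

(** Convergence along an ultrafilter picks limits at all times at once, in place
    of a diagonal extraction. *)
Lemma bounded_ultra_cvg {R : realType} (U : set_system nat) (u : nat -> R) (B : R) :
  UltraFilter U -> (forall N, 0 <= u N <= B) ->
  exists p : R, u N @[N --> U] --> p.
Proof.
move=> UU uB.
have : (u N @[N --> U]) `[0, B]%classic.
  apply: (@filterS _ U _ setT) => [N _|]; last exact: filterT.
  by rewrite /= in_itv; exact: uB.
move=> /(@segment_compact R 0 B _ _) [p [_ clp]]; exists p => V Vp.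
have [//|UV] := in_ultra_setVsetC (u @^-1` V) UU.
have : (u N @[N --> U]) (~` V) by exact: UV.
by move=> /clp /(_ Vp) [z []].
Qed.

(** Chords on either side of [t] are allowed, so that one estimate for [s <= r]
    covers both one-sided difference quotients. *)
Lemma derivative_of_chords {R : realType} (x : R -> R) (t D : R) :
  (forall e, 0 < e -> exists2 eta, 0 < eta & forall s r,
     t - eta < s -> s <= r -> r < t + eta ->
     `|x r - x s - (r - s) * D| <= (r - s) * e) ->
  derivable x t 1 /\ 'D_1 x t = D.
Proof.
move=> chords.
have cv : (fun k => k^-1 *: ((x \o shift t) (k *: 1) - x t)) @ 0^' --> D.
  apply/cvgrPdist_le => e e0; have [eta eta0 ch] := chords e e0.
  near=> k; have k0 : k != 0 by near: k; exact: nbhs_dnbhs_neq.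
  have keta : `|k| < eta.
    by near: k; apply: dnbhs0_lt.
  rewrite /= distrC /GRing.scale /= mulr1.
  have -> : k^-1 * (x (k + t) - x t) - D = k^-1 * (x (k + t) - x t - k * D).
    by field.
  rewrite normrM normfV ler_pdivrMl ?normr_gt0//.
  move: keta; rewrite ltr_norml => /andP[k1 k2].
  have [kpos|kneg] := leP 0 k.
    have := ch t (k + t); rewrite (ger0_norm kpos).
    rewrite (_ : k + t - t = k); last by ring.
    by apply; lra.
  have := ch (k + t) t; rewrite (ltr0_norm kneg).
  rewrite (_ : t - (k + t) = - k); last by ring.
  rewrite -normrN.
  rewrite (_ : - (x t - x (k + t) - - k * D) = x (k + t) - x t - k * D);
    last by ring.
  by apply; lra.
by split; [apply/cvg_ex; exists D|exact: cvg_lim cv].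
Unshelve. all: by end_near. Qed.

(** Continuity of the data makes the discrete right-hand side nearly constant
    around [t], with an error independent of [N] because the interpolants are
    uniformly bounded and Lipschitz up to the mesh; the resulting bound on chords
    then survives the pointwise limit. *)
Lemma limit_of_grid_solutions {R : realType} (a b g h : R -> R)
    (t0 l A B sigma : R) (N0 : nat) :
  0 < l -> 0 < sigma ->
  (forall t, t0 <= t -> 0 <= a t <= A /\ 0 <= b t <= B) ->
  (forall t, t0 <= t -> g t <= t <= h t) ->
  (forall t, t0 <= t -> h t - t <= sigma) ->
  (forall t, t0 < t -> [/\ {for t, continuous a}, {for t, continuous b},
    {for t, continuous g} & {for t, continuous h}]) ->
  (forall N, (N0 <= N)%N -> exists x, grid_solution a b g h t0 l N x) ->
  exists x : R -> R, [/\ forall t, t <= t0 -> x t = 1,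
    forall t, t0 <= t -> 0 < x t,
    forall c, t0 <= c -> exists2 L, 0 < L & forall s t, s <= t -> t <= c ->
      `|x t - x s| <= L * (t - s)
  & forall t, t0 < t ->
      derivable x t 1 /\ 'D_1 x t = a t * x (g t) - b t * x (h t)].
Proof.
move=> l0 sigma0 ab gh hsigma cont grids.
have [z zS] := boolp.choice (fun N => grids (N0 + N)%N (leq_addr N N0)).
pose X N t := grid_interp t0 (N0 + N) (z N) t.
pose d N : R := (N0 + N).+1%:R^-1.
have XM N c t : t0 <= c -> t <= c -> 0 < X N t <= expR (l * (c - t0)).
  exact: (grid_interp_le _ _ _ _ _ _ _ _ l0 (zS N)).
have [U [UU Uoo]] := ultraFilterLemma (eventually_filter : ProperFilter \oo).
have cvX t : exists p : R, X N t @[N --> U] --> p.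
  apply: (bounded_ultra_cvg _ _ (expR (l * (Num.max t0 t - t0))) UU) => N.
  have /andP[X0 ->] : 0 < X N t <= expR (l * (Num.max t0 t - t0)).
    by apply: XM; rewrite le_max lexx ?orbT.
  by rewrite ltW.
have [x Xx] := boolp.choice cvX.
have d0 : d N @[N --> U] --> (0 : R).
  have : d N @[N --> \oo] --> (0 : R).
    have := @cvg_harmonic R; rewrite -(cvg_shiftn N0).
    by under eq_fun do rewrite addnC.
  by move=> d0 V /d0; exact: Uoo.
have x1 t : t <= t0 -> x t = 1.
  move=> tt0; apply: (cvg_unique _ (Xx t)) => //.
  have -> : (fun N => X N t) = cst 1.
    apply/funext => N; rewrite /X /grid_interp grid_index_before//.
    by have [] := zS N.
  exact: cvg_cst.
exists x; split => //.
- move=> t t0t; apply: (@lt_le_trans _ _ (expR (l * (t - t0)))^-1).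
    by rewrite invr_gt0 expR_gt0.
  apply: (cvgr_to_ge (Xx t)); apply: nearW => N.
  exact: (grid_interp_ge _ _ _ _ _ _ _ _ l0 (zS N)).
- move=> c t0c; exists (l * expR (l * (c - t0))); first by rewrite mulr_gt0 ?expR_gt0.
  move=> s t st tc.
  have lhs : `|X N t - X N s| @[N --> U] --> `|x t - x s|.
    by apply: cvg_norm; apply: cvgB.
  have rhs : l * expR (l * (c - t0)) * ((t - s) + d N) @[N --> U] -->
      l * expR (l * (c - t0)) * ((t - s) + 0).
    by apply: cvgMr; apply: cvgD => //; exact: cvg_cst.
  rewrite -[in leRHS](addr0 (t - s)).
  apply: (ler_cvg_to lhs rhs); apply: nearW => N.
  exact: (grid_interp_lipschitz _ _ _ _ _ _ _ _ l0 (zS N)).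
move=> t t0t; apply: derivative_of_chords => e e0.
(* Near [t], all arguments of the interpolants stay below [c], where they are
   bounded by [M]; [K] collects the constants in the oscillation of the
   right-hand side. *)
pose c := t + 1 + sigma; pose M := expR (l * (c - t0)).
have t0c : t0 <= c by rewrite /c; lra.
have M0 : 0 < M by exact: expR_gt0.
have [/andP[at0 atA] /andP[bt0 btB]] := ab t (ltW t0t).
pose K := (A + B) * (l * M) + 2 * M.
have K0 : 0 < K.
  have AB : 0 <= A + B by lra.
  have : 0 <= (A + B) * (l * M) by rewrite (mulr_ge0 AB)// ltW ?mulr_gt0.
  by rewrite /K; lra.
pose eps := e / K; have eps0 : 0 < eps by rewrite divr_gt0.
have [ca cb cg ch] := cont t t0t.
have [eta eta0 near_t] : exists2 eta, 0 < eta & forall r, `|t - r| < eta ->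
    [/\ `|a t - a r| <= eps, `|b t - b r| <= eps, `|g t - g r| <= eps
      & `|h t - h r| <= eps].
  have : \forall r \near t, [/\ `|a t - a r| <= eps, `|b t - b r| <= eps,
      `|g t - g r| <= eps & `|h t - h r| <= eps].
    near=> r; split; near: r.
    - exact: (cvgr_dist_le _ _ ca).
    - exact: (cvgr_dist_le _ _ cb).
    - exact: (cvgr_dist_le _ _ cg).
    - exact: (cvgr_dist_le _ _ ch).
  by move=> /nbhs_ballP [eta eta0 sub]; exists eta => // r tr; apply: sub.
(* Halving leaves room for nodes lying up to one mesh step to the left. *)
pose eta' := Num.min (eta / 2) (Num.min 1 (t - t0)).
have eta'0 : 0 < eta' by rewrite !lt_min divr_gt0// ltr01 subr_gt0.
have [eta'1 [eta'2 eta'3]] : eta' <= eta / 2 /\ eta' <= 1 /\ eta' <= t - t0.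
  by rewrite /eta' !ge_min !lexx !orbT.
exists eta' => // s r ts sr rt.
pose F N := a t * X N (g t) - b t * X N (h t).
have /andP[gt ht] := gh t (ltW t0t); have hs := hsigma t (ltW t0t).
have gtc : g t <= c by rewrite /c; lra.
have htc : h t <= c by rewrite /c; lra.
have main : \forall N \near U, `|X N r - X N s - (r - s) * F N| <=
    ((r - s) + d N) * (K * (eps + d N)) + d N * ((A + B) * M).
  have dsmall : \forall N \near U, `|0 - d N| < eta' by exact: (cvgr_dist_lt _ _ d0).
  have rN : \forall N \near U, r < t0 + (N0 + N).+1%:R.
    apply: Uoo; near=> N.
    apply: (@lt_le_trans _ _ (t0 + N%:R)); last first.
      by rewrite lerD2l ler_nat ltnW// ltnS leq_addl.
    rewrite -ltrBlDl; near: N; exact: nbhs_infty_gtr.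
  near=> N.
  have dN : d N < eta'.
    have : `|0 - d N| < eta' by near: N.
    by rewrite sub0r normrN ger0_norm// invr_ge0.
  have d0N : 0 < d N by rewrite invr_gt0.
  have FM : `|F N| <= (A + B) * M.
    have /andP[g0 gM] := XM N _ _ t0c gtc.
    have /andP[h0 hM] := XM N _ _ t0c htc.
    rewrite /F ler_norml.
    have : a t * X N (g t) <= A * M by apply: ler_pM => //; exact: ltW.
    have : b t * X N (h t) <= B * M by apply: ler_pM => //; exact: ltW.
    have : 0 <= a t * X N (g t) by exact: mulr_ge0 at0 (ltW g0).
    have : 0 <= b t * X N (h t) by exact: mulr_ge0 bt0 (ltW h0).
    by move=> *; apply/andP; split; lra.
  apply: (le_trans (grid_interp_linear _ _ _ _ _ _ _ _ (zS N) s r (F N)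
    (K * (eps + d N)) _ _ _ _ _)) => //; first by lra.
  - by near: N.
  - exact: mulr_ge0 (ltW K0) (addr_ge0 (ltW eps0) (ltW d0N)).
  - move=> w t0w /andP[sw wr]; rewrite -/(X N (g w)) -/(X N (h w)).
    have tw : `|t - w| < eta.
      by rewrite ltr_norml; apply/andP; split; rewrite -/(d N) in sw; lra.
    have [aw bw gw hw] := near_t w tw.
    have /andP[gww wh] := gh w t0w; have hsw := hsigma w t0w.
    have [/andP[aw0 awA] /andP[bw0 bwB]] := ab w t0w.
    have lip u v : u <= c -> v <= c -> `|v - u| <= eps ->
        `|X N u - X N v| <= l * M * (eps + d N).
      move=> uc vc uv.
      have lM0 : 0 <= l * M := mulr_ge0 (ltW l0) (ltW M0).
      have [vu|uv'] := leP v u.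
        apply: (le_trans (grid_interp_lipschitz _ _ _ _ _ _ _ _ l0 (zS N) c v u t0c vu uc)).
        rewrite ler_wpM2l// lerD2r; move: uv; rewrite ler_norml => /andP[]; lra.
      rewrite distrC.
      apply: (le_trans (grid_interp_lipschitz _ _ _ _ _ _ _ _ l0 (zS N) c u v t0c (ltW uv') vc)).
      rewrite ler_wpM2l// lerD2r; move: uv; rewrite ler_norml => /andP[]; lra.
    have gwc : g w <= c by rewrite /c; lra.
    have hwc : h w <= c by rewrite /c; lra.
    have lipg := lip _ _ gwc gtc gw; have liph := lip _ _ hwc htc hw.
    have /andP[g0 gM] := XM N _ _ t0c gtc.
    have /andP[h0 hM] := XM N _ _ t0c htc.
    (* Separate the oscillation of the interpolants from that of the
       coefficients. *)
    have -> : a w * X N (g w) - b w * X N (h w) - F N =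
      (a w * (X N (g w) - X N (g t)) - b w * (X N (h w) - X N (h t))) +
      ((b t - b w) * X N (h t) - (a t - a w) * X N (g t)) by rewrite /F; ring.
    have T1 : `|a w * (X N (g w) - X N (g t))| <= A * (l * M * (eps + d N)).
      by rewrite normrM (ger0_norm aw0) ler_pM.
    have T2 : `|b w * (X N (h w) - X N (h t))| <= B * (l * M * (eps + d N)).
      by rewrite normrM (ger0_norm bw0) ler_pM.
    have T3 : `|(b t - b w) * X N (h t)| <= eps * M.
      by rewrite normrM (gtr0_norm h0) ler_pM// ltW.
    have T4 : `|(a t - a w) * X N (g t)| <= eps * M.
      by rewrite normrM (gtr0_norm g0) ler_pM// ltW.
    apply: (le_trans (ler_normD _ _)).
    apply: (le_trans (lerD (ler_normB _ _) (ler_normB _ _))).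
    have : 0 <= M * d N := mulr_ge0 (ltW M0) (ltW d0N).
    by rewrite /K; lra.
  - by rewrite lerD2l ler_pM2l.
have lhs : `|X N r - X N s - (r - s) * F N| @[N --> U] -->
    `|x r - x s - (r - s) * (a t * x (g t) - b t * x (h t))|.
  apply: cvg_norm; apply: cvgB; first exact: cvgB.
  by apply: cvgMr; apply: cvgB; apply: cvgMr.
have rhs : ((r - s) + d N) * (K * (eps + d N)) + d N * ((A + B) * M) @[N --> U] -->
    ((r - s) + 0) * (K * (eps + 0)) + 0 * ((A + B) * M).
  apply: cvgD; last exact: cvgMl.
  apply: cvgM; first by apply: cvgD => //; exact: cvg_cst.
  by apply: cvgMr; apply: cvgD => //; exact: cvg_cst.
apply: (le_trans (ler_cvg_to lhs rhs main)).
have KE : K * (e / K) = e by field; rewrite gt_eqF.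
by rewrite !addr0 mul0r addr0 /eps KE.
Unshelve. all: by end_near. Qed.

(** * The nonoscillatory solution *)

Lemma continuous_at_pos {R : realType} (f : R -> R) :
  {within half_line, continuous f} -> forall t, 0 < t -> {for t, continuous f}.
Proof.
move=> fc t t0.
have : {within `]0, +oo[%classic, continuous f}.
  apply: continuous_subspaceW fc => s; rewrite /half_line /= !in_itv /= !andbT.
  exact: ltW.
rewrite continuous_open_subspace; last exact: interval_open.
by apply; rewrite inE /= in_itv /= t0.
Qed.

Lemma unif_continuous_on_continuous {R : realType} (D : set R) (f : R -> R) :
  unif_continuous_on D f -> {within D, continuous f}.
Proof.
move=> fu x; apply/cvg_entourageP => E entE.
have := fu E entE; rewrite /= => fE.
have := nbhs_entourage (x : subspace D) fE.
by apply: filterS => y /xsectionP.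
Qed.

Lemma lipschitz_abs_continuous {R : realType} (c d L : R) (f : R -> R) : 0 < L ->
  (forall s t, s <= t -> t <= d -> `|f t - f s| <= L * (t - s)) ->
  abs_continuous_on c d f.
Proof.
move=> L0 lip eps eps0; exists (eps / L); first exact: divr_gt0.
move=> n u v uv _ small.
apply: (@le_lt_trans _ _ (L * \sum_(i < n) (v i - u i))).
  by rewrite mulr_sumr; apply: ler_sum => i _; have [_ ? ?] := uv i; exact: lip.
by rewrite mulrC -ltr_pdivlMr.
Qed.

Theorem corollary3p1 (R : realType) (a b g h : R -> R)
  (a_ge0 : forall t : R, 0 <= t -> 0 <= a t)
  (b_ge0 : forall t : R, 0 <= t -> 0 <= b t)
  (g_le : forall t : R, 0 <= t -> g t <= t)
  (h_ge : forall t : R, 0 <= t -> t <= h t)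
  (g_lim : g t @[t --> +oo] --> +oo)
  (a_cont : {within half_line, continuous a})
  (b_cont : {within half_line, continuous b})
  (a_bnd : [bounded a t | t in half_line])
  (b_bnd : [bounded b t | t in half_line])
  (g_uc : unif_continuous_on half_line g)
  (h_uc : unif_continuous_on half_line h)
  (a1 a2 b1 b2 tau sigma t1 : R)
  (a1_gt0 : 0 < a1) (a2_gt0 : 0 < a2) (b1_gt0 : 0 < b1) (b2_gt0 : 0 < b2)
  (tau_gt0 : 0 < tau) (sigma_gt0 : 0 < sigma) (t1_gt0 : 0 < t1)
  (a_bounds : forall t : R, t1 <= t -> a1 <= a t <= a2)
  (b_bounds : forall t : R, t1 <= t -> b1 <= b t <= b2)
  (g_delay : forall t : R, t1 <= t -> t - g t <= tau)
  (h_advance : forall t : R, t1 <= t -> h t - t <= sigma)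
  (cond :
    (b2 < a1 /\ 0 < a2 - b1 < (tau + sigma)^-1 * ln (a1 / b2)) \/
    (a2 < b1 /\ 0 < b2 - a1 < (tau + sigma)^-1 * ln (b1 / a2)))
  (t0 : R) (t0_ge0 : 0 <= t0) (t1_le_t0 : t1 <= t0) :
  exists (phi : R -> R) (x0 : R) (x : R -> R),
    is_solution a b g h t0 phi x0 x /\ nonoscillatory x.
Proof.
have ab t : t0 <= t -> a1 <= a t <= a2 /\ b1 <= b t <= b2.
  by move=> /(le_trans t1_le_t0) t1t; rewrite a_bounds// b_bounds.
have gh t : t0 <= t -> g t <= t <= h t.
  by move=> /(le_trans t0_ge0) t_ge0; rewrite g_le// h_ge.
have gh_delay t : t0 <= t -> t - g t <= tau /\ h t - t <= sigma.
  by move=> /(le_trans t1_le_t0) t1t; rewrite g_delay// h_advance.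
have [l l_gt0 [N0 grids]] : exists2 l, 0 < l & exists N0, forall N, (N0 <= N)%N ->
    exists x, grid_solution a b g h t0 l N x.
  case: cond => -[_ small].
    exact: (increasing_grid_solution _ _ _ _ _ _ _ _ _ _ _ a1_gt0 b1_gt0 b2_gt0
      tau_gt0 sigma_gt0 ab gh gh_delay small).
  exact: (decreasing_grid_solution _ _ _ _ _ _ _ _ _ _ _ a1_gt0 a2_gt0 b1_gt0
    tau_gt0 sigma_gt0 ab gh gh_delay small).
have [x [x1 xpos xlip xder]] : exists x : R -> R, [/\ forall t, t <= t0 -> x t = 1,
    forall t, t0 <= t -> 0 < x t,
    forall c, t0 <= c -> exists2 L, 0 < L & forall s t, s <= t -> t <= c ->
      `|x t - x s| <= L * (t - s)
  & forall t, t0 < t ->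
      derivable x t 1 /\ 'D_1 x t = a t * x (g t) - b t * x (h t)].
  apply: (limit_of_grid_solutions a b g h t0 l a2 b2 sigma N0) => //.
  - move=> t /ab[/andP[at1 at2] /andP[bt1 bt2]].
    rewrite at2 bt2 !andbT; split; apply: ltW.
      exact: lt_le_trans at1.
    exact: lt_le_trans bt1.
  - by move=> t /gh_delay[].
  - move=> t t0t; have t_gt0 : 0 < t by exact: le_lt_trans t0t.
    split; apply: continuous_at_pos => //; exact: unif_continuous_on_continuous.
exists (fun=> 1), 1, x; split; last first.
  by exists t0 => t t0t; rewrite gt_eqF// xpos.
split.
- by move=> c t0c; have [L L0 lip] := xlip c t0c; exact: lipschitz_abs_continuous lip.
(* The equation can only fail at [t0] itself, where [x] may have a corner. *)
- exists [set t0]; split; first exact: measurable_set1.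
    exact: lebesgue_measure_set1.
  move=> t /= /not_implyP[t0t fails]; apply: contra_notP fails => tt0.
  have [dx ->] : derivable x t 1 /\ 'D_1 x t = a t * x (g t) - b t * x (h t).
    by apply: xder; rewrite lt_neqAle t0t andbT eq_sym; apply/eqP.
  by split => //; ring.
- by move=> t /ltW/x1.
- by rewrite x1.
Qed.
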